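(* Let $\mathcal{F}=\{f_{n}\}_{n\in\mathbb{N}}$ be a time varying map on a compact metric space $(X,d)$. (a) If $\mathcal{F}$ is strongly expansive, then $\mathcal{F}$ has the shadowing property if and only if $\mathcal{F}$ has the h-shadowing property. (b) If $\mathcal{F}$ is strongly expansive and has the shadowing property, then $\mathcal{F}$ has the h-shadowing and s-limit shadowing properties. If in addition all the maps $f_n$ are surjective, then $\mathcal{F}$ has the limit shadowing property.
   Context: $\mathbb{N}=\{1,2,3,\dots\}$. A time varying map on a metric space $(X,d)$ is a sequence $\mathcal{F}=\{f_n\}_{n\in\mathbb{N}}$ of continuous maps $f_n:X\to X$. Put $\mathcal{F}_n:=f_n\circ f_{n-1}\circ\cdots\circ f_1$ for $n\ge 1$, $\mathcal{F}_0:=\mathrm{Id}_X$, and $\mathcal{F}_{[i,j]}:=f_j\circ f_{j-1}\circ\cdots\circ f_i$ for $1\le i\le j$. Strongly expansive: there exists $\gamma>0$ such that for any two distinct points $x,y\in X$ and every $N\in\mathbb{N}$, $d(\mathcal{F}_{[N,n]}(x),\mathcal{F}_{[N,n]}(y))>\gamma$ for some $n\ge N$. For $\delta>0$, a sequence $\{x_n\}_{n\ge 0}$ in $X$ is a $\delta$-pseudo orbit of $\mathcal{F}$ if $d(f_{n+1}(x_n),x_{n+1})<\delta$ for all $n\ge 0$; a finite sequence $\{x_0,\dots,x_m\}$ is a finite $\delta$-pseudo orbit if $d(f_{n+1}(x_n),x_{n+1})<\delta$ for all $0\le n<m$. A sequence $\{x_n\}_{n\ge0}$ is a limit pseudo orbit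 if $d(f_{n+1}(x_n),x_{n+1})\to 0$ as $n\to+\infty$. Shadowing property: for every $\varepsilon>0$ there is $\delta>0$ such that for every $\delta$-pseudo orbit $\{x_n\}_{n\ge0}$ in $X$ there is $x\in X$ with $d(\mathcal{F}_n(x),x_n)<\varepsilon$ for all $n\ge0$. h-shadowing property: for every $\varepsilon>0$ there is $\delta>0$ such that for every finite $\delta$-pseudo orbit $\{x_0,\dots,x_m\}$ in $X$ there is $x\in X$ with $d(\mathcal{F}_n(x),x_n)<\varepsilon$ for every $0\le n<m$ and $\mathcal{F}_m(x)=x_m$. Limit shadowing property: for every limit pseudo orbit $\{x_n\}_{n\ge0}$ in $X$ there is $x\in X$ with $d(\mathcal{F}_n(x),x_n)\to 0$ as $n\to+\infty$. s-limit shadowing property: for every $\varepsilon>0$ there is $\delta>0$ such that (1) for every $\delta$-pseudo orbit $\{x_n\}_{n\ge0}$ in $X$ there exists $x\in X$ with $d(\mathcal{F}_n(x),x_n)<\varepsilon$ for all $n\ge 0$, and (2) if in addition $\{x_n\}_{n\ge0}$ is a limit pseudo orbit, then (this $x$ can be taken so that) $d(\mathcal{F}_n(x),x_n)\to0$ as $n\to+\infty$. *)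

(* Defs.v *)
From mathcomp Require Import all_boot all_order all_algebra.
From mathcomp Require Import all_classical all_reals all_analysis.

Set Implicit Arguments.
Unset Strict Implicit.
Unset Printing Implicit Defensive.

Import Order.TTheory GRing.Theory Num.Theory.
Import numFieldNormedType.Exports.
Local Open Scope classical_set_scope.
Local Open Scope ring_scope.

(* A time varying map is indexed by the positive integers: the value [f 0] is
   a dummy, and none of the notions below depends on it. *)
Section TimeVaryingMaps.
Context {R : realType} {X : metricType R}.
Implicit Types (f : nat -> X -> X) (x : nat -> X).

Definition time_varying_map f : Prop :=
  forall n, (0 < n)%N -> continuous (f n).

(* f_j \o ... \o f_i, meant for 1 <= i <= j; it is the identity if j < i. *)
Definition tv_comp f (i j : nat) : X -> X :=
  fun z => foldl (fun y k => f k y) z (index_iota i j.+1).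

(* f_n \o ... \o f_1, and in particular the identity for n = 0. *)
Definition tv_iter f (n : nat) : X -> X := tv_comp f 1 n.

Definition strongly_expansive f : Prop :=
  exists2 gamma : R, 0 < gamma &
    forall y z : X, y <> z -> forall N, (0 < N)%N ->
      exists2 n, (N <= n)%N & gamma < mdist (tv_comp f N n y) (tv_comp f N n z).

Definition pseudo_orbit f (delta : R) x : Prop :=
  forall n, mdist (f n.+1 (x n)) (x n.+1) < delta.

(* The finite sequence x_0, ..., x_m is represented by any infinite sequence
   extending it; the terms of index > m are irrelevant. *)
Definition finite_pseudo_orbit f (delta : R) (m : nat) x : Prop :=
  forall n, (n < m)%N -> mdist (f n.+1 (x n)) (x n.+1) < delta.

Definition limit_pseudo_orbit f x : Prop :=
  mdist (f n.+1 (x n)) (x n.+1) @[n --> \oo] --> (0 : R).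

Definition shadows f (eps : R) (z : X) x : Prop :=
  forall n, mdist (tv_iter f n z) (x n) < eps.

Definition limit_shadows f (z : X) x : Prop :=
  mdist (tv_iter f n z) (x n) @[n --> \oo] --> (0 : R).

Definition shadowing_property f : Prop :=
  forall eps : R, 0 < eps -> exists2 delta : R, 0 < delta &
    forall x, pseudo_orbit f delta x -> exists z, shadows f eps z x.

Definition h_shadowing_property f : Prop :=
  forall eps : R, 0 < eps -> exists2 delta : R, 0 < delta &
    forall m x, finite_pseudo_orbit f delta m x ->
      exists z, (forall n, (n < m)%N -> mdist (tv_iter f n z) (x n) < eps) /\
                tv_iter f m z = x m.

Definition limit_shadowing_property f : Prop :=
  forall x, limit_pseudo_orbit f x -> exists z, limit_shadows f z x.

Definition s_limit_shadowing_property f : Prop :=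
  forall eps : R, 0 < eps -> exists2 delta : R, 0 < delta &
    forall x, pseudo_orbit f delta x ->
      (exists z, shadows f eps z x) /\
      (limit_pseudo_orbit f x ->
         exists z, shadows f eps z x /\ limit_shadows f z x).

End TimeVaryingMaps.

(* Main.v *)
(** Expansivity from time [N + 1] on makes [F_N z] depend only on a coarse
    tracing of the tail of an orbit: two orbits that stay [gamma]-close from
    time [N] on coincide from time [N] on.  Continuing a finite pseudo orbit by
    the true orbit of its last point therefore turns shadowing into h-shadowing.
    For s-limit shadowing, h-shadowing provides a true orbit through the [N]-th
    point of the pseudo orbit, even if the maps are not surjective; replacing
    the initial part by it gives a pseudo orbit as fine as the tail, and a point
    shadowing it finely has the same orbit from time [N] on as the point
    shadowing the whole pseudo orbit coarsely. *)
Require Import Defs.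
From mathcomp Require Import all_boot all_order all_algebra.
From mathcomp Require Import all_classical all_reals all_analysis.
From mathcomp Require Import lra.
Import Order.TTheory GRing.Theory Num.Theory.
Import numFieldNormedType.Exports.
Local Open Scope classical_set_scope.
Local Open Scope ring_scope.

Section Iterates.
Context {R : realType} {X : metricType R}.
Implicit Types (f : nat -> X -> X) (x : nat -> X).

Lemma tv_comp_nil f n z : tv_comp f n.+1 n z = z.
Proof. by rewrite /tv_comp /index_iota subnn. Qed.

Lemma tv_compS f i j z : (i <= j.+1)%N ->
  tv_comp f i j.+1 z = f j.+1 (tv_comp f i j z).
Proof.
move=> ij; rewrite /tv_comp /index_iota subSn// -addn1 iotaD foldl_cat /=.
by rewrite subnKC.
Qed.

Lemma tv_iter0 f z : tv_iter f 0 z = z.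
Proof. exact: tv_comp_nil. Qed.

Lemma tv_iterS f n z : tv_iter f n.+1 z = f n.+1 (tv_iter f n z).
Proof. exact: tv_compS. Qed.

Lemma tv_iter_comp f m n z : (m <= n)%N ->
  tv_iter f n z = tv_comp f m.+1 n (tv_iter f m z).
Proof.
elim: n => [|n IH]; first by rewrite leqn0 => /eqP ->; rewrite tv_comp_nil.
rewrite leq_eqVlt => /predU1P[->|mn]; first by rewrite tv_comp_nil.
by rewrite tv_iterS tv_compS// IH.
Qed.

Lemma continuous_tv_iter f n : time_varying_map f -> continuous (tv_iter f n).
Proof.
move=> f_tv; elim: n => [|n IH] z.
  rewrite (_ : tv_iter f 0 = id); first exact: cvg_id.
  by apply/funext => y; exact: tv_iter0.
rewrite (_ : tv_iter f n.+1 = f n.+1 \o tv_iter f n); last first.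
  by apply/funext => y; exact: tv_iterS.
by apply: continuous_comp; [exact: IH|exact: f_tv].
Qed.

Lemma tv_iter_surj f n : (forall k, (0 < k)%N -> forall y, exists z, f k z = y) ->
  forall y, exists z, tv_iter f n z = y.
Proof.
move=> f_surj; elim: n => [|n IH] y; first by exists y; exact: tv_iter0.
have [u <-] := f_surj n.+1 isT y; have [z <-] := IH u.
by exists z; exact: tv_iterS.
Qed.

(** Expansivity from time [N.+1] on, applied to the two [N]-th iterates. It is assumed with an
    explicit [gamma], since shadowing accuracies are chosen in terms of it. *)
Lemma tv_iter_eq_of_close f (gamma : R) y z N :
  (forall u v : X, u <> v -> forall M, (0 < M)%N ->
    exists2 n, (M <= n)%N & gamma < mdist (tv_comp f M n u) (tv_comp f M n v)) ->
  (forall n, (N <= n)%N -> mdist (tv_iter f n y) (tv_iter f n z) <= gamma) ->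
  tv_iter f N y = tv_iter f N z.
Proof.
move=> expf close; apply: contrapT => /expf /(_ N.+1 isT)[n Nn].
by rewrite -!tv_iter_comp 1?ltnW// ltNge close// ltnW.
Qed.

Lemma mdist_cvg0P (u v : nat -> X) :
  mdist (u n) (v n) @[n --> \oo] --> (0 : R) <->
  forall e : R, 0 < e ->
    exists N, forall n, (N <= n)%N -> mdist (u n) (v n) < e.
Proof.
split=> [/cvgr0Pnorm_lt uv e e0|uv].
  have [N _ NP] := uv e e0; exists N => n Nn.
  by have := NP n Nn; rewrite /= ger0_norm ?mdist_ge0.
apply/cvgr0Pnorm_lt => e /uv[N NP]; exists N => // n Nn.
by rewrite /= ger0_norm ?mdist_ge0// NP.
Qed.

(** The initial part is a true orbit and meets [x] exactly at time [N], so all errors come from the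
    tail. *)
Lemma pseudo_orbit_splice f (d : R) N w x : 0 < d -> tv_iter f N w = x N ->
  (forall n, (N <= n)%N -> mdist (f n.+1 (x n)) (x n.+1) < d) ->
  pseudo_orbit f d (fun n => if (n < N)%N then tv_iter f n w else x n).
Proof.
move=> d0 wx xP n; have [Nn|nN] := leqP N n.
  by rewrite ltnNge leqW//=; exact: xP.
rewrite -tv_iterS; case: ltnP => [_|Nn]; first by rewrite mdistxx.
by rewrite (_ : n.+1 = N) ?wx ?mdistxx//; apply/eqP; rewrite eqn_leq nN.
Qed.

Lemma shadowing_h_shadowing f : strongly_expansive f ->
  shadowing_property f -> h_shadowing_property f.
Proof.
move=> [g g0 expf] shf e e0.
have eg0 : 0 < Num.min e g by rewrite lt_min e0.
have [d d0 dP] := shf _ eg0; exists d => // m x xP.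
(* At [n = m] the composition is empty, so [y m = x m]. *)
pose y n := if (n < m)%N then x n else tv_comp f m.+1 n (x m).
have yP : pseudo_orbit f d y.
  move=> n; rewrite /y; have [mn|nm] := leqP m n.
    by rewrite ltnNge leqW//= -tv_compS// mdistxx.
  case: ltnP => [_|mn]; first exact: xP.
  have -> : m = n.+1 by apply/eqP; rewrite eqn_leq nm andbT.
  by rewrite tv_comp_nil xP.
have [z zP] := dP y yP; exists z; split=> [n nm|].
  by have := zP n; rewrite /y nm lt_min => /andP[].
apply: contrapT => /expf /(_ m.+1 isT)[n mn].
rewrite -tv_iter_comp 1?ltnW// ltNge => /negP; apply.
by have := zP n; rewrite /y ltnNge (ltnW mn)/= lt_min => /andP[_ /ltW].
Qed.

(** A cluster point of points tracing longer and longer initial segments traces the whole pseudo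
    orbit, by continuity of each iterate. *)
Lemma h_shadowing_shadowing f : compact [set: X] -> time_varying_map f ->
  h_shadowing_property f -> shadowing_property f.
Proof.
move=> cX f_tv hf e e0; have e20 : 0 < e / 2 by rewrite divr_gt0.
have [d d0 dP] := hf _ e20; exists d => // x xP.
have /choice[z zP] : forall m, exists z,
    forall n, (n < m)%N -> mdist (tv_iter f n z) (x n) < e / 2.
  by move=> m; have [z [zP _]] := dP m x (fun n _ => xP n); exists z.
have [|p [_ pP]] := cX (z @ \oo) _; first exact: filterT.
exists p => n.
have nearp : nbhs p [set w | mdist (tv_iter f n p) (tv_iter f n w) < e / 2].
  have := continuous_tv_iter f n f_tv p _ (nbhsx_ballx _ _ e20).
  by rewrite ballEmdist.
have nearz : (z @ \oo) [set w | mdist (tv_iter f n w) (x n) < e / 2].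
  by exists n.+1 => // m; exact: zP.
have [w [/= wx pw]] := pP _ _ nearz nearp.
rewrite (splitr e); apply: le_lt_trans (ltrD pw wx).
exact: metric_triangle.
Qed.

Lemma shadowing_s_limit_shadowing f : strongly_expansive f ->
  shadowing_property f -> s_limit_shadowing_property f.
Proof.
move=> expf shf; have hf := shadowing_h_shadowing f expf shf.
have [g g0 gP] := expf.
move=> e e0.
(* Half of [g], because [z] and a finer tracing point are compared through [x]. *)
have eg0 : 0 < Num.min e (g / 2) by rewrite lt_min e0 divr_gt0.
have [d d0 dP] := shf _ eg0.
have [d' d'0 d'P] := hf _ e0.
exists (Num.min d d'); first by rewrite lt_min d0.
move=> x xP.
have [z zP] : exists z, shadows f (Num.min e (g / 2)) z x.
  by apply: dP => n; have := xP n; rewrite lt_min => /andP[].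
have ze : shadows f e z x by move=> n; have := zP n; rewrite lt_min => /andP[].
split=> [|/mdist_cvg0P xlim]; exists z => //; split=> //.
apply/mdist_cvg0P => e1 e10.
have eg1 : 0 < Num.min e1 (g / 2) by rewrite lt_min e10 divr_gt0.
have [d1 d10 d1P] := shf _ eg1.
have [N NP] := xlim _ d10; exists N => n Nn.
(* Only the exact hit at time [N] matters here; [w] need not follow [x] closely before. *)
have [w [_ wx]] : exists w, (forall k, (k < N)%N ->
    mdist (tv_iter f k w) (x k) < e) /\ tv_iter f N w = x N.
  by apply: d'P => k _; have := xP k; rewrite lt_min => /andP[].
have [z1 z1P] := d1P _ (pseudo_orbit_splice f d1 N w x d10 wx NP).
have z1x k : (N <= k)%N -> mdist (tv_iter f k z1) (x k) < Num.min e1 (g / 2).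
  by move=> Nk; have := z1P k; rewrite ltnNge Nk.
(* The point [z1] depends on [e1] but [z] does not, so this makes [z] itself limit shadow [x]. *)
suff -> : tv_iter f n z = tv_iter f n z1.
  by have := z1x n Nn; rewrite lt_min => /andP[].
apply: (tv_iter_eq_of_close f g) => // k nk.
apply: le_trans (metric_triangle _ (x k) _) _.
have := z1x k (leq_trans Nn nk); have := zP k.
rewrite !lt_min (metric_sym (x k)) => /andP[_ ?] /andP[_ ?]; lra.
Qed.

(** Early errors of a limit pseudo orbit may be large, so surjectivity supplies the orbit through
    [x N] that replaces them. The accuracy [1] is arbitrary, as only the limit clause is used. *)
Lemma s_limit_shadowing_limit_shadowing f :
  (forall n, (0 < n)%N -> forall y, exists z, f n z = y) ->
  s_limit_shadowing_property f -> limit_shadowing_property f.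
Proof.
move=> f_surj sf x /mdist_cvg0P xlim; have [d d0 dP] := sf 1 ltr01.
have [N NP] := xlim _ d0; have [w wx] := tv_iter_surj f N f_surj (x N).
have yP := pseudo_orbit_splice f d N w x d0 wx NP.
have [_ [|z [_ /mdist_cvg0P zlim]]] := dP _ yP.
  apply/mdist_cvg0P => e /xlim[M MP]; exists (maxn N M) => n.
  by rewrite geq_max => /andP[Nn Mn]; rewrite !ltnNge Nn leqW//=; exact: MP.
exists z; apply/mdist_cvg0P => e /zlim[M MP]; exists (maxn N M) => n.
rewrite geq_max => /andP[Nn /MP].
by rewrite ltnNge Nn.
Qed.

End Iterates.

Theorem corollary4p4 (R : realType) (X : metricType R) (f : nat -> X -> X)
    (X_compact : compact [set: X]) (f_tv : time_varying_map f) :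
  (strongly_expansive f -> (shadowing_property f <-> h_shadowing_property f)) /\
  (strongly_expansive f -> shadowing_property f ->
     (h_shadowing_property f /\ s_limit_shadowing_property f) /\
     ((forall n, (0 < n)%N -> forall y, exists x, f n x = y) ->
        limit_shadowing_property f)).
Proof.
split=> [expf|expf shf].
  by split; [exact: shadowing_h_shadowing|exact: h_shadowing_shadowing].
have sf := shadowing_s_limit_shadowing _ expf shf.
split; first by split; first exact: shadowing_h_shadowing.
by move=> f_surj; exact: s_limit_shadowing_limit_shadowing.
Qed.
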